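(* Let $1\le n\le m$ be integers with $n\mid m$. Then: (i) the number of non-isomorphic regular dessins whose automorphism group is isomorphic to $\mathbb{Z}_n\oplus\mathbb{Z}_m$ equals $\psi(m/n)$, where $\psi$ is the Dedekind totient function; (ii) the number of (non-isomorphic) symmetric dessins whose automorphism group is isomorphic to $\mathbb{Z}_n\oplus\mathbb{Z}_m$ equals the number of solutions $e\in\mathbb{Z}_{m/n}$ of $e^2\equiv1\pmod{m/n}$; (iii) the group $\mathbb{Z}_n\oplus\mathbb{Z}_m$ underlies a unique regular dessin if and only if $m=n$, in which case this dessin is totally symmetric.
   Context: A regular dessin with automorphism group isomorphic to $G$ is a triple $(G,x,y)$ with $x,y$ generating the finite group $G$; $(G,x_1,y_1)\cong(G,x_2,y_2)$ if $x_1\mapsto x_2$, $y_1\mapsto y_2$ extends to an automorphism of $G$. It is symmetric if $x\mapsto y$, $y\mapsto x$ extends to an automorphism of $G$. Let $\Delta=\langle X,Y\mid -\rangle$ be free of rank 2; the dessin is totally symmetric if for every $\sigma\in\mathrm{Aut}(\Delta)$, writing $\sigma(X)=u(X,Y)$, $\sigma(Y)=v(X,Y)$, the assignment $x\mapsto u(x,y)$, $y\mapsto v(x,y)$ extends to an automorphism of $G$. The Dedekind totient function is $\psi(k)=k\prod_{q\mid k,\ q\text{ prime}}(1+1/q)$, $\psi(1)=1$. *)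

(* Defs.v *)
From HB Require Import structures.
From mathcomp Require Import all_boot all_order all_algebra all_fingroup.
From mathcomp Require Import all_solvable.

Set Implicit Arguments.
Unset Strict Implicit.
Unset Printing Implicit Defensive.

Local Open Scope group_scope.

(* The free group of rank 2, as the group of reduced words. The letter (g, e) *)
(* is the generator X (g = false) or Y (g = true), inverted when e = true.    *)
Notation letter := (bool * bool)%type.

Definition linv (a : letter) : letter := (a.1, ~~ a.2).

Definition reduced (w : seq letter) : bool :=
  sorted (fun a b => b != linv a) w.

Definition push (a : letter) (w : seq letter) : seq letter :=
  if w is b :: w' then if b == linv a then w' else a :: w else [:: a].

Definition wmul (u v : seq letter) : seq letter := foldr push v u.

Definition winv (w : seq letter) : seq letter := rev (map linv w).

Lemma linvK : involutive linv.
Proof. by case=> g e; rewrite /linv /= negbK. Qed.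

Lemma push_reduced a w : reduced w -> reduced (push a w).
Proof.
case: w => [|b w] //= bw; case: eqP => [_|/eqP nab]; first exact: path_sorted bw.
by rewrite /= nab.
Qed.

Lemma pushK a w : reduced w -> push (linv a) (push a w) = w.
Proof.
case: w => [|b w] /=; first by rewrite linvK eqxx.
case: (b =P linv a) => [->|_ _] /=; last by rewrite linvK eqxx.
by case: w => [|c w] //= /andP[/negPf-> _].
Qed.

Lemma wmul_reduced u v : reduced v -> reduced (wmul u v).
Proof. by move=> rv; elim: u => //= a u; apply: push_reduced. Qed.

Lemma wmul_push a v w : reduced w -> wmul (push a v) w = push a (wmul v w).
Proof.
move=> rw; case: v => [|b v] //=; case: eqP => //= ->.
by rewrite -{1}[a]linvK pushK //; apply: wmul_reduced.
Qed.

Lemma wmulA u v w : reduced w -> wmul u (wmul v w) = wmul (wmul u v) w.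
Proof. by move=> rw; elim: u => //= a u ->; rewrite wmul_push. Qed.

Lemma wmulw1 w : reduced w -> wmul w [::] = w.
Proof.
elim: w => //= a w IHw aw; rewrite IHw; last exact: path_sorted aw.
by case: w aw {IHw} => //= b w /andP[/negPf->].
Qed.

Lemma wmul_cat u v w : wmul (u ++ v) w = wmul u (wmul v w).
Proof. by rewrite /wmul foldr_cat. Qed.

Lemma winv_reduced w : reduced w -> reduced (winv w).
Proof.
rewrite /reduced /winv rev_sorted sorted_map; apply: sub_sorted => a b /=.
by apply: contraNneq => ->; rewrite !linvK.
Qed.

Lemma wmulVr w v : reduced v -> wmul (winv w) (wmul w v) = v.
Proof.
move=> rv; elim: w => //= a w IHw.
by rewrite /winv /= rev_cons -cats1 wmul_cat /= pushK //; apply: wmul_reduced.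
Qed.

Lemma winvK : involutive winv.
Proof. by move=> w; rewrite /winv map_rev revK mapK //; apply: linvK. Qed.

Record F2 : Type := MkF2 { F2word :> seq letter; F2wordP : reduced F2word }.
HB.instance Definition _ := [isSub for F2word].
HB.instance Definition _ := [Choice of F2 by <:].

Definition F2one : F2 := @MkF2 [::] isT.
Definition F2mul (u v : F2) : F2 := MkF2 (wmul_reduced u (F2wordP v)).
Definition F2inv (u : F2) : F2 := MkF2 (winv_reduced (F2wordP u)).

Fact F2mulA : associative F2mul.
Proof. by move=> u v w; apply: val_inj; rewrite /= wmulA //; apply: F2wordP. Qed.

Fact F2mul1g : left_id F2one F2mul.
Proof. by move=> u; apply: val_inj. Qed.

Fact F2mulg1 : right_id F2one F2mul.
Proof. by move=> u; apply: val_inj; apply: wmulw1; apply: F2wordP. Qed.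

Fact F2mulVg : left_inverse F2one F2inv F2mul.
Proof.
move=> u; apply: val_inj => /=.
by rewrite -{2}(wmulw1 (F2wordP u)) wmulVr.
Qed.

Fact F2mulgV : right_inverse F2one F2inv F2mul.
Proof.
move=> u; apply: val_inj => /=.
by rewrite -{1}(winvK u) -{2}(wmulw1 (winv_reduced (F2wordP u))) wmulVr.
Qed.

HB.instance Definition _ :=
  isGroup.Build F2 F2mulA F2mul1g F2mulg1 F2mulVg F2mulgV.

Definition F2X : F2 := @MkF2 [:: (false, false)] isT.
Definition F2Y : F2 := @MkF2 [:: (true, false)] isT.

Section WordEvaluation.

Variables (H : groupType) (x y : H).

Definition leval (a : letter) : H :=
  let g := if a.1 then y else x in if a.2 then g^-1 else g.

Definition F2eval (w : F2) : H := \prod_(a <- F2word w) leval a.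

Lemma leval_inv a : leval (linv a) = (leval a)^-1.
Proof. by case: a => g [] /=; rewrite /leval /= ?invgK. Qed.

Lemma F2evalX : F2eval F2X = x. Proof. by rewrite /F2eval big_seq1. Qed.
Lemma F2evalY : F2eval F2Y = y. Proof. by rewrite /F2eval big_seq1. Qed.

Lemma F2evalM : {morph F2eval : u v / u * v}.
Proof.
move=> u v; rewrite /F2eval /=; elim: (F2word u) => [|a w IHw] /=.
  by rewrite big_nil mul1g.
rewrite big_cons -mulgA -IHw; case: (wmul w v) => [|b s] /=.
  by rewrite big_seq1 big_nil mulg1.
case: eqP => [->|_]; last by rewrite big_cons.
by rewrite big_cons leval_inv mulKVg.
Qed.

End WordEvaluation.

(* With F2evalX, F2evalY and F2evalM: F2 is free on F2X and F2Y. *)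
Lemma F2eval_unique (H : groupType) (f : F2 -> H) :
  {morph f : u v / u * v} -> f =1 F2eval (f F2X) (f F2Y).
Proof.
move=> fM.
have f1 : f 1 = 1 by apply: (mulgI (f 1)); rewrite -fM !mulg1.
have fV u : f u^-1 = (f u)^-1.
  by apply: (mulgI (f u)); rewrite -fM !mulgV.
have fl a : f (@MkF2 [:: a] isT) = leval (f F2X) (f F2Y) a.
  case: a => [[] []]; rewrite /leval //= -fV;
    by congr f; apply: val_inj.
case=> w rw; rewrite /F2eval /=; elim: w rw => [|a w IHw] rw.
  by rewrite big_nil -f1; congr f; apply: val_inj.
have rw' : reduced w by exact: path_sorted rw.
rewrite big_cons -(IHw rw') -fl -fM; congr f; apply: val_inj => /=.
by case: w rw {IHw rw'} => //= b w /andP[/negPf->].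
Qed.

Section RegularDessins.

Variables (gT : finGroupType) (G : {group gT}).

(* The regular dessin (G, x, y) is represented by the pair (x, y). *)
Definition dessins : {set gT * gT} := [set d | <<[set d.1; d.2]>> == G :> {set gT}].

(* x1 |-> x2, y1 |-> y2 extends to an automorphism of G *)
Definition extends_to_aut (d1 d2 : gT * gT) : bool :=
  [exists f in Aut G, (f d1.1 == d2.1) && (f d1.2 == d2.2)].

Definition dessin_iso : rel (gT * gT) := extends_to_aut.

Definition symmetric_dessin (d : gT * gT) : bool :=
  extends_to_aut d (d.2, d.1).

Definition totally_symmetric_dessin (d : gT * gT) : Prop :=
  forall s : {multiplicative F2 -> F2}, bijective s ->
    extends_to_aut d (F2eval d.1 d.2 (s F2X), F2eval d.1 d.2 (s F2Y)).

Lemma dessin_iso_equiv : {in dessins & &, equivalence_rel dessin_iso}.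
Proof.
have refl d : dessin_iso d d.
  by apply/exists_inP; exists 1; rewrite ?group1 // !perm1 !eqxx.
have sym d1 d2 : dessin_iso d1 d2 -> dessin_iso d2 d1.
  case/exists_inP=> f fA /andP[/eqP f1 /eqP f2]; apply/exists_inP.
  by exists f^-1; rewrite ?groupV // -f1 -f2 !permK !eqxx.
have trans d1 d2 d3 : dessin_iso d1 d2 -> dessin_iso d2 d3 -> dessin_iso d1 d3.
  case/exists_inP=> f fA /andP[/eqP f1 /eqP f2].
  case/exists_inP=> h hA /andP[/eqP h1 /eqP h2]; apply/exists_inP.
  by exists (f * h); rewrite ?groupM // !permM f1 f2 h1 h2 !eqxx.
move=> d1 d2 d3 _ _ _; split=> // d12; apply/idP/idP; last exact: trans.
exact: trans (sym _ _ d12).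
Qed.

Definition iso_classes (D : {set gT * gT}) : {set {set gT * gT}} :=
  equivalence_partition dessin_iso D.

Definition nb_regular_dessins : nat := #|iso_classes dessins|.

Definition nb_symmetric_dessins : nat :=
  #|iso_classes [set d in dessins | symmetric_dessin d]|.

Definition underlies_unique_dessin : Prop :=
  exists2 d, d \in dessins & {in dessins, forall d', dessin_iso d d'}.

End RegularDessins.

Definition dedekind_psi (k : nat) : rat :=
  (k%:R * \prod_(q <- primes k) (1 + q%:R^-1))%R.

(* Main.v *)
Require Import Defs.
From HB Require Import structures.
From mathcomp Require Import all_boot all_order all_algebra all_fingroup.
From mathcomp Require Import all_solvable.
From mathcomp Require Import ring.

(* Write k = m/n. The n-th powers of G form a cyclic group C = <c> of order k,
   and G/C has order n^2, so a relation x^a y^b = 1 between generators of G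
   forces n to divide a and b. Hence the isomorphism class of (G, x, y) is
   determined by the generating pair (x^n, y^n) of C up to Aut(C) = (Z/k)^*,
   and every generating pair (c^a, c^b) arises: a and b lift to coprime
   integers, that is, to the first row of a unimodular matrix. There are
   phi(k) psi(k) pairs (a, b) mod k with gcd(a, b, k) = 1 (multiplicativity and
   prime powers), and (Z/k)^* acts freely on them, which gives psi(k) classes.
   The dessin is symmetric exactly when (x^n, y^n) is equivalent to (c, c^e)
   with e^2 = 1 mod k. Finally psi(k) = 1 only for k = 1, and an
   automorphism of the free group maps generating pairs to generating pairs, so
   a unique dessin is totally symmetric. *)

Set Implicit Arguments.
Unset Strict Implicit.
Unset Printing Implicit Defensive.

Import Order.TTheory GRing.Theory Num.Theory.

(** * Primitive pairs modulo k and the Dedekind totient function *)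

Lemma coprime_lift k a b : 0 < k -> coprime (gcdn a b) k ->
  exists a' b', [/\ 0 < a', a' = a %[mod k], b' = b %[mod k] & coprime a' b'].
Proof.
(* A prime dividing a' divides exactly one of c and t, hence divides t * k + c
   only if it divides a, b and k. *)
move=> k_gt0 co_abk; pose a' := a + k; pose c := b + k.
pose t := a'`_(\pi(c)^').
have [a'_gt0 c_gt0] : 0 < a' /\ 0 < c by rewrite !addn_gt0 k_gt0 !orbT.
have b'_gt0 : 0 < t * k + c by rewrite addn_gt0 c_gt0 orbT.
exists a', (t * k + c); split; rewrite ?modnMDl ?modnDr //.
rewrite coprime_has_primes //; apply/hasPn=> p /=.
rewrite !mem_primes a'_gt0 => /and3P[p_pr _ p_b'];
  apply/negP=> /and3P[_ _ p_a'].
have p_tE : (p %| t) = ~~ (p %| c).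
  have -> : (p %| t) = (p \in primes t).
    by rewrite mem_primes p_pr (part_gt0 _ a' : 0 < t).
  rewrite primes_part mem_filter !inE /= !mem_primes p_pr a'_gt0 p_a'.
  by rewrite c_gt0 /= andbT.
have [p_c|pNc] := boolP (p %| c); last first.
  by move: p_b'; rewrite dvdn_addr ?(negPf pNc) // dvdn_mulr // p_tE.
move: p_b'; rewrite dvdn_addl // Euclid_dvdM // p_tE p_c /= => p_k.
move: p_a' p_c; rewrite !dvdn_addl // => p_a p_b.
have : p %| gcdn (gcdn a b) k by rewrite !dvdn_gcd p_a p_b.
by rewrite (eqP co_abk) dvdn1 => /eqP p1; rewrite p1 in p_pr.
Qed.

(** These are the pairs that generate the additive group Z/k; modulo units they form the projective
    line over Z/k. *)
Definition primitive_pairs k : {set 'I_k * 'I_k} :=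
  [set p : 'I_k * 'I_k | coprime (gcdn p.1 p.2) k].

Lemma coprime_gcdn_mod k a b :
  coprime (gcdn (a %% k) (b %% k)) k = coprime (gcdn a b) k.
Proof.
by rewrite /coprime -!gcdnA gcdn_modl gcdnCA gcdn_modl gcdnCA.
Qed.

(** Chinese remainder theorem: reducing both coordinates modulo [k] and modulo [l] is injective, and
    a pair is primitive modulo [k * l] exactly when both reductions are primitive. *)
Lemma card_primitive_pairsM k l : 0 < k -> 0 < l -> coprime k l ->
  #|primitive_pairs (k * l)| = #|primitive_pairs k| * #|primitive_pairs l|.
Proof.
move=> k0 l0 co_kl; have kl0 : 0 < k * l by rewrite muln_gt0 k0.
pose r q (q0 : 0 < q) a : 'I_q := Ordinal (ltn_pmod a q0).
pose f (p : 'I_(k * l) * 'I_(k * l)) :=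
  ((r k k0 p.1, r k k0 p.2), (r l l0 p.1, r l l0 p.2)).
have f_inj : injective f.
  have inj1 (a b : 'I_(k * l)) : a = b %[mod k] -> a = b %[mod l] -> a = b.
    move=> ek el; apply: val_inj; rewrite /= -(modn_small (ltn_ord a)).
    rewrite -(modn_small (ltn_ord b)); apply/eqP.
    by rewrite chinese_remainder // ek el !eqxx.
  by move=> [a b] [a' b'] [] *; congr pair; apply: inj1.
rewrite -cardsX -(card_imset _ f_inj); apply: eq_card => -[[a b] [a' b']].
apply/imsetP/setXP => /= [[[c d]] | []].
  rewrite !inE /= coprimeMr => /andP[ck cl] [-> -> -> ->] /=.
  by rewrite !coprime_gcdn_mod.
rewrite !inE /= => ck cl;
  exists (r _ kl0 (chinese k l a a'), r _ kl0 (chinese k l b b')).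
  rewrite inE /= coprime_gcdn_mod coprimeMr -(coprime_gcdn_mod k).
  rewrite -[X in _ && X]coprime_gcdn_mod !chinese_modl // !chinese_modr //.
  by rewrite !coprime_gcdn_mod ck.
have [k_kl l_kl] : k %| k * l /\ l %| k * l by rewrite dvdn_mulr ?dvdn_mull.
rewrite /f /=; congr (_, _, (_, _)); apply: val_inj; rewrite /= modn_dvdm //.
1,2: by rewrite chinese_modl ?modn_small.
all: by rewrite chinese_modr ?modn_small.
Qed.

(** A pair fails to be primitive modulo a power of [p] exactly when [p] divides both entries; such
    pairs are [p] times an arbitrary pair modulo [p ^ e.-1]. The additive form avoids truncated
    subtraction. *)
Lemma card_primitive_pairs_pfactor p e : prime p -> 0 < e ->
  #|primitive_pairs (p ^ e)| + (p ^ e.-1) ^ 2 = (p ^ e) ^ 2.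
Proof.
case: e => // e p_pr _; rewrite /=.
have p0 := prime_gt0 p_pr.
have ltM (a : 'I_(p ^ e)) : p * a < p ^ e.+1 by rewrite expnS ltn_pmul2l.
pose f (q : 'I_(p ^ e) * 'I_(p ^ e)) := (Ordinal (ltM q.1), Ordinal (ltM q.2)).
have f_inj : injective f.
  move=> [a b] [a' b'] [] /eqP + /eqP;
    rewrite !eqn_pmul2l // => /eqP ea /eqP eb.
  by congr pair; apply: val_inj.
have -> : (p ^ e) ^ 2 = #|f @: [set: 'I_(p ^ e) * 'I_(p ^ e)]|.
  by rewrite (card_imset _ f_inj) cardsT card_prod card_ord.
have -> : f @: setT = ~: primitive_pairs (p ^ e.+1).
  apply/setP=> -[a b]; rewrite !inE /= coprime_pexpr // coprime_sym
    prime_coprime // negbK.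
  rewrite dvdn_gcd; apply/imsetP/andP => [[[c d] _ [-> ->]]|[pa pb]].
    by rewrite !dvdn_mulr.
  have ltD (c : 'I_(p ^ e.+1)) : p %| c -> c %/ p < p ^ e.
    by move=> pc; rewrite ltn_divLR // -expnSr.
  exists (Ordinal (ltD _ pa), Ordinal (ltD _ pb)) => //.
  by congr pair; apply: val_inj; rewrite /= mulnC divnK.
by rewrite cardsC card_prod card_ord.
Qed.

(** Strong induction: for [p] the least prime divisor of [k], the p-part is a prime power and the
    coprime cofactor is smaller than [k]. *)
Lemma multiplicative_eq (T : Type) (op : T -> T -> T) (F H : nat -> T) :
    F 1 = H 1 ->
    (forall a b, 0 < a -> 0 < b -> coprime a b -> F (a * b) = op (F a) (F b)) ->
    (forall a b, 0 < a -> 0 < b -> coprime a b -> H (a * b) = op (H a) (H b)) ->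
    (forall p e, prime p -> 0 < e -> F (p ^ e) = H (p ^ e)) ->
  forall k, 0 < k -> F k = H k.
Proof.
move=> FH1 FM HM FHp; elim/ltn_ind=> k IHk k_gt0.
have [k_le1|k_gt1] := leqP k 1.
  by rewrite (_ : k = 1) //; apply/eqP; rewrite eqn_leq k_le1.
pose p := pdiv k; have p_pr : prime p by apply: pdiv_prime.
have logp : 0 < logn p k by rewrite logn_gt0 mem_primes p_pr k_gt0 pdiv_dvd.
have lt_k : k`_p^' < k.
  rewrite -[ltnRHS](partnC p k_gt0) ltn_Pmull ?part_gt0 // p_part.
  by rewrite -(expn0 p) ltn_exp2l // prime_gt1.
rewrite -(partnC p k_gt0) FM ?HM ?part_gt0 ?coprime_partC //.
by rewrite (IHk _ lt_k) ?part_gt0 // p_part FHp.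
Qed.

Lemma dedekind_psiM a b : 0 < a -> 0 < b -> coprime a b ->
  dedekind_psi (a * b) = (dedekind_psi a * dedekind_psi b)%R.
Proof.
move=> a0 b0 co_ab; rewrite /dedekind_psi.
have /(perm_big _) -> : perm_eq (primes (a * b)) (primes a ++ primes b).
  apply: uniq_perm; rewrite ?primes_uniq //.
    by rewrite cat_uniq !primes_uniq /= andbT -coprime_has_primes.
  by move=> p; rewrite mem_cat primesM.
by rewrite big_cat /= natrM mulrACA.
Qed.

Lemma card_primitive_pairs k : 0 < k ->
  (#|primitive_pairs k|%:R = (totient k)%:R * dedekind_psi k :> rat)%R.
Proof.
apply: (@multiplicative_eq rat (fun x y => x * y)%R
  (fun k => #|primitive_pairs k|%:R)%R
  (fun k => (totient k)%:R * dedekind_psi k)%R).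
- rewrite /dedekind_psi big_nil !mulr1 /= -[RHS]/(1%:R)%R; congr (_%:R)%R.
  have -> : primitive_pairs 1 = setT by apply/setP=> q; rewrite !inE coprimen1.
  by rewrite cardsT card_prod card_ord.
- by move=> a b a0 b0 co_ab; rewrite card_primitive_pairsM // natrM.
- move=> a b a0 b0 co_ab; rewrite totient_coprime // dedekind_psiM // natrM.
  by rewrite mulrACA.
move=> p e p_pr e0; have := card_primitive_pairs_pfactor p_pr e0.
rewrite totient_pfactor // /dedekind_psi primesX // primes_prime // big_seq1.
case: e e0 => // e _ /=; have p0 := prime_gt0 p_pr.
move/(congr1 (fun i => i%:R : rat)%R); rewrite natrD => /(canRL (addrK _)) ->.
rewrite natrM -subn1 natrB // !natrX (exprS _ e).
have : (p%:R != 0 :> rat)%R by rewrite pnatr_eq0 -lt0n.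
(* With q the e-th power of p, the identity is (p q)^2 - q^2 = (p - 1) q * (p q (1 + 1/p)). *)
by move=> pn0; move: (p%:R ^+ e)%R => q; field.
Qed.

(** * Transport of equivalence classes along a map *)

(** Since [f] preserves and reflects the relation, each class is the full preimage in [D] of its
    image, so taking images is a bijection between classes even when [f] identifies points. *)
Lemma equivalence_partition_imset (T T' : finType) (f : T -> T') (D : {set T})
    (R : rel T) (R' : rel T') :
    {in D & &, equivalence_rel R} ->
    {in D &, forall x y, R x y = R' (f x) (f y)} ->
  {in f @: D & &, equivalence_rel R'} /\
  #|equivalence_partition R D| = #|equivalence_partition R' (f @: D)|.
Proof.
move=> eqR fR; split.
  move=> _ _ _ /imsetP[x Dx ->] /imsetP[y Dy ->] /imsetP[z Dz ->].
  by rewrite -!fR //; apply: eqR.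
pose cl x := [set y in D | R x y].
have clE x : x \in D -> f @: cl x = [set y in f @: D | R' (f x) y].
  move=> Dx; apply/setP=> y'; rewrite inE; apply/imsetP/andP.
    by case=> y /[!inE] /andP[Dy xy] ->; rewrite imset_f // -fR.
  by case=> /imsetP[y Dy ->]; rewrite -fR // => xy; exists y; rewrite // inE Dy.
have -> : equivalence_partition R' (f @: D) =
    (fun B : {set T} => f @: B) @: equivalence_partition R D.
  rewrite /equivalence_partition -!imset_comp; apply: eq_in_imset => x Dx /=.
  by rewrite -clE.
rewrite card_in_imset // => _ _ /imsetP[x Dx ->] /imsetP[y Dy ->] eq_f.
have xy : R x y.
  have : f y \in f @: cl x.
    by rewrite eq_f imset_f // inE Dy (eqR y y y Dy Dy Dy).1.
  by rewrite clE // inE -fR // => /andP[].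
apply/setP=> z; rewrite !inE; case Dz: (z \in D) => //=.
by rewrite (eqR x y z Dx Dy Dz).2.
Qed.

Local Open Scope group_scope.

(** * Generators of a group isomorphic to the direct sum of Z/n and Z/m *)

Lemma isog_Zp_product n m (gT : finGroupType) (G : {group gT}) :
    0 < n -> 0 < m -> G \isog setX (Zp n) (Zp m) ->
  [/\ abelian G, #|G| = (n * m)%N &
    exists u v, [/\ u \in G, v \in G, #[u] = m, v ^+ n = 1
      & forall z, z \in G -> exists a b, z = u ^+ a * v ^+ b]].
Proof.
move=> n_gt0 m_gt0 isoG.
(* The case [q = 1] is separate: the type ['Z_1] has two elements and [Zp 1] is its trivial
   subgroup. *)
have ZpE q : 0 < q -> exists2 z : 'Z_q, Zp q = <[z]> & #[z] = q.
  case: q => // -[|q] _; first by exists 1; rewrite ?cycle1 ?order1.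
  exists Zp1; last by rewrite order_Zp1.
  by rewrite -Zp_cycle.
have [z Zz oz] := ZpE n n_gt0; have [w Zw ow] := ZpE m m_gt0.
have cardG : #|G| = (n * m)%N by rewrite (card_isog isoG) cardsX !card_Zp.
have pE i : ((1, w) ^+ i = (1, w ^+ i) :> 'Z_n * 'Z_m)
    /\ ((z, 1) ^+ i = (z ^+ i, 1) :> 'Z_n * 'Z_m).
  elim: i => [|i [IH1 IH2]] //; rewrite !expgS IH1 IH2.
  by split; congr pair; rewrite /= ?mulg1.
have pX (a b : nat) :
    (z ^+ a, w ^+ b) = (1, w) ^+ b * (z, 1) ^+ a :> 'Z_n * 'Z_m.
  by rewrite (pE b).1 (pE a).2; congr pair; rewrite /= ?mulg1 ?mul1g.
have abX : abelian (setX (Zp n) (Zp m)).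
  apply/centsP=> -[a b] _ [a' b'] _; congr pair; exact: Zp_mulgC.
split=> //; first by rewrite (isog_abelian isoG).
have /isogP[f injf fE] : setX (Zp n) (Zp m) \isog G by rewrite isog_sym.
have Xu : (1, w) \in setX (Zp n) (Zp m) by rewrite inE group1 Zw cycle_id.
have Xv : (z, 1) \in setX (Zp n) (Zp m) by rewrite inE group1 Zz cycle_id.
have wE : (1, w) ^+ m = 1 :> 'Z_n * 'Z_m.
  by rewrite (pE m).1 -[X in w ^+ X]ow expg_order.
exists (f (1, w)), (f (z, 1)); split; rewrite -?fE ?mem_morphim //.
- rewrite order_injm //; apply/eqP; rewrite eqn_dvd order_dvdn wE eqxx /=.
  rewrite -[X in X %| _]ow order_dvdn.
  by have := expg_order (1 : 'Z_n, w); rewrite (pE _).1 => -[->].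
- by rewrite -morphX // (pE n).2 -[X in z ^+ X]oz expg_order; apply: morph1.
move=> _ /morphimP[[a b] Xab _ ->].
have [/cycleP[i ->] /cycleP[j ->]] : a \in <[z]> /\ b \in <[w]>.
  by move/setXP: Xab; rewrite -Zz -Zw.
exists j, i.
by rewrite pX morphM ?groupX // !morphX.
Qed.

(** * Dessins on an abelian group and their relations *)

Section AbelianDessins.

Variables (gT : finGroupType) (G : {group gT}).
Hypothesis abG : abelian G.

Lemma dessin_memG d : d \in dessins G -> d.1 \in G /\ d.2 \in G.
Proof. by rewrite inE => /eqP <-; rewrite !mem_gen ?inE ?eqxx ?orbT. Qed.

Lemma dessin_swap d : ((d.2, d.1) \in dessins G) = (d \in dessins G).
Proof. by rewrite !inE /= setUC. Qed.

Lemma expgM_abelian x y a : x \in G -> y \in G ->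
  (x * y) ^+ a = x ^+ a * y ^+ a.
Proof. by move=> Gx Gy; rewrite expgMn //; apply: (centsP abG). Qed.

Lemma dessin_expE d z : d \in dessins G -> z \in G ->
  exists a b, z = d.1 ^+ a * d.2 ^+ b.
Proof.
move=> Dd; have [Gx Gy] := dessin_memG Dd.
have -> : G = <[d.1]> * <[d.2]> :> {set gT}.
  rewrite -cent_joinEr ?joing_idl ?joing_idr; first by move: Dd;
    rewrite inE => /eqP.
  by apply: (sub_abelian_cent2 abG); rewrite cycle_subG.
by case/mulsgP=> _ _ /cycleP[a ->] /cycleP[b ->] ->; exists a, b.
Qed.

(** If every relation of [d1] holds in [d2], sending each product of powers of the first pair to the
    same product for the second is a well-defined endomorphism; it is onto because [d2] generates
    [G]. *)
Lemma extends_to_aut_relations d1 d2 : d1 \in dessins G -> d2 \in dessins G ->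
    (forall a b, d1.1 ^+ a * d1.2 ^+ b = 1 -> d2.1 ^+ a * d2.2 ^+ b = 1) ->
  extends_to_aut G d1 d2.
Proof.
move=> D1 D2 rel12.
have [Gx1 Gy1] := dessin_memG D1; have [Gx2 Gy2] := dessin_memG D2.
have ab := centsP abG.
pose ev (d : gT * gT) (p : nat * nat) := d.1 ^+ p.1 * d.2 ^+ p.2.
have Gev1 p : ev d1 p \in G by rewrite groupM ?groupX.
have Gev2 p : ev d2 p \in G by rewrite groupM ?groupX.
have evD d p q : d \in dessins G ->
    ev d (p.1 + q.1, p.2 + q.2)%N = ev d p * ev d q.
  move=> Dd; have [Gx Gy] := dessin_memG Dd.
  rewrite /ev /= !expgD -!mulgA; congr (_ * _); rewrite !mulgA; congr (_ * _).
  by apply: ab; rewrite groupX.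
(* Exponents are natural numbers, so inversion multiplies them by [#|G|.-1]. *)
have evV d p : d \in dessins G ->
    ev d (p.1 * #|G|.-1, p.2 * #|G|.-1)%N = (ev d p)^-1.
  move=> Dd; have [Gx Gy] := dessin_memG Dd.
  have xV x i : x \in G -> x ^+ (i * #|G|.-1) = x ^- i.
    move=> Gx'; apply: (mulgI (x ^+ i));
      rewrite -expgD -mulnS prednK ?cardG_gt0 //.
    by rewrite mulnC expgM expg_cardG // expg1n mulgV.
  by rewrite /ev /= !xV // invMg; apply: ab; rewrite groupV groupX.
have ev12 p q : ev d1 p = ev d1 q -> ev d2 p = ev d2 q.
  move=> eq1; apply/eqP; rewrite eq_mulgV1 -evV // -evD //; apply/eqP/rel12.
  by rewrite -/(ev d1 (_, _)) (evD d1 p (_, _)) // evV // eq1 mulgV.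
(* The implication makes the property satisfiable for every [z], so that [xchoose] gives a total
   function. *)
have ex z : exists p : nat * nat, (z \in G) ==> (z == ev d1 p).
  have [Gz|_] := boolP (z \in G); last by exists (0, 0)%N.
  by have [a [b ->]] := dessin_expE D1 Gz; exists (a, b) => /=.
pose g z := ev d2 (xchoose (ex z)).
have gE p : g (ev d1 p) = ev d2 p.
  by apply: ev12; apply/esym/eqP; apply: (implyP (xchooseP (ex (ev d1 p)))).
have exG z : z \in G -> exists p, z = ev d1 p.
  by move=> Gz; have [a [b ->]] := dessin_expE D1 Gz; exists (a, b).
have gM : {in G &, {morph g : a b / a * b}}.
  move=> _ _ /exG[p ->] /exG[q ->].
  by rewrite -evD // !gE evD.
pose gm := Morphism gM.
have gx : g d1.1 = d2.1.
  by have := gE (1, 0)%N; rewrite /ev /= !expg0 !mulg1.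
have gy : g d1.2 = d2.2.
  by have := gE (0, 1)%N; rewrite /ev /= !expg0 !mul1g.
have imG : gm @* G = G.
  apply/eqP; rewrite eqEsubset; apply/andP; split.
    by apply/subsetP=> _ /morphimP[z _ Gz ->]; apply: Gev2.
  have /eqP {1}<- : <<[set d2.1; d2.2]>> == G by move: D2; rewrite inE.
  rewrite gen_subG; apply/subsetP=> z /set2P[] ->; rewrite -?gx -?gy;
    exact: (mem_morphim gm).
(* A map from a finite set onto itself is injective. *)
have injg : 'injm gm.
  by apply/injmP/imset_injP; rewrite -morphimEdom imG.
apply/exists_inP; exists (aut injg imG); first exact: Aut_aut.
by rewrite !autE //= gx gy !eqxx.
Qed.

End AbelianDessins.

(** * Units modulo k and orders of powers *)

Lemma coprime_of_expn2_mod k e : e ^ 2 == 1 %[mod k] -> coprime e k.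
Proof.
move=> e2; rewrite -(@coprime_pexpl 2) // -coprime_modl (eqP e2).
by rewrite coprime_modl coprime1n.
Qed.

Lemma card_units_ord k : #|[set e : 'I_k | coprime e k]| = totient k.
Proof.
rewrite totient_count_coprime big_mkord -sum1dep_card big_mkcond.
by apply: eq_bigr => e _; rewrite coprime_sym; case: coprime.
Qed.

Lemma coprime_order_expg (gT : finGroupType) (x : gT) e :
  #[x ^+ e] = #[x] -> coprime e #[x].
Proof.
rewrite orderXgcd coprime_sym => o; apply/eqP.
have /esym/eqP := divnK (dvdn_gcdl #[x] e); rewrite o.
by rewrite -{1}[#[x]]muln1 eqn_pmul2l ?order_gt0 // => /eqP.
Qed.

Lemma expg_ord_inj (gT : finGroupType) (x : gT) k (e f : 'I_k) :
  #[x] = k -> x ^+ e = x ^+ f -> e = f.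
Proof.
move=> o_x /eqP; rewrite eq_expg_mod_order o_x !modn_small // => /eqP.
exact: val_inj.
Qed.

(** * Isomorphism classes through pairs of n-th powers *)

Section DessinClasses.

Variables (gT : finGroupType) (G : {group gT}) (n k : nat) (u v : gT).
Hypotheses (n_gt0 : 0 < n) (k_gt0 : 0 < k).
Hypotheses (abG : abelian G) (cardG : #|G| = (n * (n * k))%N).
Hypotheses (Gu : u \in G) (Gv : v \in G).
Hypotheses (ord_u : #[u] = (n * k)%N) (expv_n : v ^+ n = 1).
Hypothesis genG : forall z, z \in G -> exists a b, z = u ^+ a * v ^+ b.

Let c := u ^+ n.

Let order_c : #[c] = k.
Proof. by rewrite orderXdiv ord_u ?dvdn_mulr // mulKn. Qed.

Let expc_mod i : c ^+ (i %% k) = c ^+ i.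
Proof. by rewrite -order_c expg_mod_order. Qed.

Let Gc : c \in G. Proof. exact: groupX. Qed.

Let expn_cycle z : z \in G -> exists i : 'I_k, z ^+ n = c ^+ i.
Proof.
case/genG=> a [b ->]; rewrite (expgM_abelian abG) ?groupX //.
rewrite -[_ ^+ b ^+ n]expgM mulnC expgM expv_n expg1n mulg1 -expgM mulnC expgM
  -/c.
exists (Ordinal (ltn_pmod a k_gt0)).
by rewrite /= expc_mod.
Qed.

Lemma dessin_relation_dvd d a b : d \in dessins G ->
  d.1 ^+ a * d.2 ^+ b = 1 -> (n %| a) && (n %| b).
Proof.
(* G has n^2 k elements, all of the form x^i y^j c^l with i, j < n and l < k, so
   these expressions are unique. *)
move=> Dd; have [Gx Gy] := dessin_memG Dd.
pose h (t : 'I_n * 'I_n * 'I_k) := d.1 ^+ t.1.1 * d.2 ^+ t.1.2 * c ^+ t.2.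
pose r i : 'I_n := Ordinal (ltn_pmod i n_gt0).
have hE i j : exists l, d.1 ^+ i * d.2 ^+ j = h (r i, r j, l).
  have [s xs] := expn_cycle Gx; have [t yt] := expn_cycle Gy.
  exists (Ordinal (ltn_pmod (s * (i %/ n) + t * (j %/ n)) k_gt0)).
  rewrite /h /= expc_mod.
  rewrite expgD !expgM -xs -yt -!expgM.
  rewrite {1}(divn_eq i n) {1}(divn_eq j n) addnC [(_ + j %% n)%N]addnC !expgD.
  rewrite ![(_ %/ n * n)%N]mulnC -!mulgA; congr (_ * _); rewrite !mulgA;
    congr (_ * _).
  by apply: (centsP abG); rewrite groupX.
have h_inj : injective h.
  suff h_injT : {in setT &, injective h} by move=> s t; apply: h_injT;
    rewrite inE.
  apply/imset_injP; rewrite eqn_leq leq_imset_card /=.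
  rewrite cardsT !card_prod !card_ord -mulnA -cardG;
    apply/subset_leq_card/subsetP.
  move=> z /(dessin_expE abG Dd)[i [j ->]]; have [l ->] := hE i j.
  exact: imset_f.
have [l ->] := hE a b => h1.
have /h_inj[ra rb _] : h (r a, r b, l) = h (r 0%N, r 0%N, Ordinal k_gt0).
  by rewrite h1 /h /= mod0n !expg0 !mulg1.
by rewrite /dvdn ra rb mod0n.
Qed.

Definition power_pair (d : gT * gT) := (d.1 ^+ n, d.2 ^+ n).

(** On pairs in [<[c]>] this is the orbit relation of Aut(C), whose elements are the power maps with
    exponent prime to [k]. *)
Definition unit_multiple : rel (gT * gT) := fun p q =>
  [exists e : 'I_k, coprime e k && (q == (p.1 ^+ e, p.2 ^+ e))].

(** An automorphism maps [c] to a power of [c] of the same order, hence acts on n-th powers as a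
    unit exponent. Conversely, every relation of [d1] has exponents divisible by [n], so it is a
    relation between n-th powers, and raising it to the power [e] gives the relation of [d2]. *)
Lemma dessin_iso_unit_multiple : {in dessins G &, forall d1 d2,
  dessin_iso G d1 d2 = unit_multiple (power_pair d1) (power_pair d2)}.
Proof.
move=> [x1 y1] [x2 y2] D1 D2.
have [/= Gx1 Gy1] := dessin_memG D1; have [/= Gx2 Gy2] := dessin_memG D2.
apply/idP/existsP.
  case/exists_inP=> f fA /= /andP[/eqP fx /eqP fy].
  pose g := [morphism of autm fA].
  have gX z i : z \in G -> f (z ^+ i) = f z ^+ i by exact: (morphX g).
  have Gf z : z \in G -> f z \in G by move=> Gz; rewrite -(autmE fA) Aut_closed.
  have [e fc] : exists e : 'I_k, f c = c ^+ e.
    by rewrite gX //; apply/expn_cycle/Gf.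
  exists e; apply/andP; split.
    rewrite -[X in coprime _ X]order_c; apply: coprime_order_expg; rewrite -fc.
    exact: (order_injm (injm_autm fA) Gc).
  have fp z : z \in G -> f z ^+ n = z ^+ n ^+ e.
    move=> Gz; have [i zi] := expn_cycle Gz.
    by rewrite -gX // zi gX // fc -[LHS]expgM -[RHS]expgM mulnC.
  by rewrite /power_pair /= -fx -fy !fp.
case=> e /andP[co_e /eqP[/= x2E y2E]].
apply: extends_to_aut_relations => //= a b rel.
have /andP[] := dessin_relation_dvd D1 rel.
move=> /dvdnP[a' aE] /dvdnP[b' bE]; move: rel;
  rewrite /= aE bE ![(_ * n)%N]mulnC !expgM => rel.
rewrite x2E y2E -!expgM ![(e * _)%N]mulnC !expgM -(expgM_abelian abG) ?groupX
  //.
by rewrite rel expg1n.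
Qed.

(** These are the pairs generating [<[c]>], written through exponents so that they can be counted
    modulo [k]. *)
Definition cyclic_generating_pairs : {set gT * gT} :=
  [set (c ^+ nat_of_ord p.1, c ^+ nat_of_ord p.2) | p in primitive_pairs k].

Lemma imset_power_pair : power_pair @: dessins G = cyclic_generating_pairs.
Proof.
apply/setP=> p; apply/imsetP/imsetP.
  case=> d Dd ->; have [Gx Gy] := dessin_memG Dd.
  have [a xa] := expn_cycle Gx; have [b yb] := expn_cycle Gy.
  exists (a, b); last by rewrite /power_pair xa yb.
  (* Taking n-th powers of u = x^i y^j gives c = c^(a i + b j), so a i + b j is 1 modulo [k]. *)
  have [i [j uE]] := dessin_expE abG Dd Gu.
  have : c ^+ (a * i + b * j) == c ^+ 1.
    rewrite expgD !expgM -xa -yb -!expgM ![(n * _)%N]mulnC !expgM.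
    by rewrite -(expgM_abelian abG) ?groupX // -uE expg1.
  rewrite eq_expg_mod_order order_c inE /= => /eqP ij1.
  set g := gcdn a b.
  have gd : gcdn g k %| a * i + b * j.
    apply: (dvdn_trans (dvdn_gcdl g k)).
    by rewrite dvdn_add // dvdn_mulr // ?dvdn_gcdl ?dvdn_gcdr.
  have : coprime (gcdn g k) (a * i + b * j).
    apply: (coprime_dvdl (dvdn_gcdr g k)).
    by rewrite -coprime_modr ij1 coprime_modr coprimen1.
  by rewrite /coprime => /eqP co; move: gd => /gcdn_idPl; rewrite co => <-.
case=> [[a b]]; rewrite inE /= => co_ab ->.
have [a' [b' [a'_gt0 a'E b'E co_ab']]] := coprime_lift k_gt0 co_ab.
case: (egcdnP b' a'_gt0) => s r; rewrite (eqP co_ab') => Bez _.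
(* The exponents of [x] and [y] form a matrix of determinant s a' - r b' = 1; inverting it gives u =
   x^s y^(-r) and v = y^a' x^(-b'). The powers of [v] vanish in n-th powers. *)
pose x := u ^+ a' * v ^+ r; pose y := u ^+ b' * v ^+ s.
have Gx : x \in G by rewrite groupM ?groupX.
have Gy : y \in G by rewrite groupM ?groupX.
exists (x, y); last first.
  have pE i j l : i = j %[mod k] -> c ^+ j = (u ^+ i * v ^+ l) ^+ n.
    move=> ij; rewrite (expgM_abelian abG) ?groupX // -[_ ^+ l ^+ n]expgM mulnC
      expgM.
    rewrite expv_n expg1n mulg1 -[_ ^+ i ^+ n]expgM mulnC expgM -/c; apply/eqP.
    by rewrite eq_expg_mod_order order_c ij.
  by congr pair; apply: pE.
rewrite inE /= eqEsubset gen_subG; apply/andP; split.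
  by apply/subsetP=> z /set2P[] ->.
set H := <<_>>; have Hx : x \in H by rewrite mem_gen // set21.
have Hy : y \in H by rewrite mem_gen // set22.
have ab := centsP abG.
have Hu : u \in H.
  have : x ^+ s = u * y ^+ r.
    rewrite /x /y !(expgM_abelian abG) ?groupX // -!expgM mulnC Bez.
    by rewrite addn1 expgS ![(r * _)%N]mulnC -mulgA.
  by move/esym/(canRL (mulgK _)) ->; rewrite groupM ?groupV ?groupX.
have Hv : v \in H.
  have : y ^+ a' = v * x ^+ b'.
    rewrite /x /y !(expgM_abelian abG) ?groupX // -!expgM Bez addn1 expgS.
    by rewrite [(a' * _)%N]mulnC !mulgA; congr (_ * _); apply: ab;
      rewrite ?groupX.
  by move/esym/(canRL (mulgK _)) ->; rewrite groupM ?groupV ?groupX.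
by apply/subsetP=> z /genG[i [j ->]]; rewrite groupM ?groupX.
Qed.

(** Freeness of the action: [k] divides a(e - f) and b(e - f), hence gcd(a, b)(e - f), and gcd(a, b)
    is prime to [k]. *)
Lemma expg_unit_inj p (e f : 'I_k) : p \in cyclic_generating_pairs ->
  p.1 ^+ e = p.1 ^+ f -> p.2 ^+ e = p.2 ^+ f -> e = f.
Proof.
case/imsetP=> -[a b]; rewrite inE /= => co_ab -> /=.
have dvd_k (i : 'I_k) : (c ^+ i) ^+ e = (c ^+ i) ^+ f -> i * e = i * f %[mod k].
  by move/eqP; rewrite -[X in X == _]expgM -[X in _ == X]expgM
    eq_expg_mod_order order_c => /eqP.
move=> /dvd_k ea /dvd_k eb {dvd_k}; apply: val_inj => /=.
wlog le_fe : e f ea eb / f <= e => [W|].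
  by case/orP: (leq_total e f) => [/W ->|/W ->].
apply/eqP; rewrite -(modn_small (ltn_ord e)) -(modn_small (ltn_ord f)).
move/eqP: ea; rewrite eqn_mod_dvd ?leq_mul2l ?le_fe ?orbT // -mulnBr => ea.
move/eqP: eb; rewrite eqn_mod_dvd ?leq_mul2l ?le_fe ?orbT // -mulnBr => eb.
rewrite eqn_mod_dvd // -(@Gauss_dvdr k (gcdn a b)) 1?coprime_sym //.
by rewrite muln_gcdl dvdn_gcd ea eb.
Qed.

Lemma card_unit_multiple p : p \in cyclic_generating_pairs ->
  #|[set q in cyclic_generating_pairs | unit_multiple p q]| = totient k.
Proof.
move=> Sp; rewrite -card_units_ord.
pose f (e : 'I_k) := (p.1 ^+ e, p.2 ^+ e).
rewrite -(@card_in_imset _ _ f); last first.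
  by move=> e1 e2 _ _ [] /(expg_unit_inj Sp) + /[dup] => /[apply].
apply: eq_card => q; rewrite inE; apply/andP/imsetP.
  by case=> _ /existsP[e /andP[co_e /eqP->]]; exists e; rewrite ?inE.
case=> e; rewrite inE => co_e ->; split; last first.
  by apply/existsP; exists e; rewrite co_e /=.
case/imsetP: Sp => -[a b]; rewrite inE /= => co_ab pE.
pose r i : 'I_k := Ordinal (ltn_pmod i k_gt0).
apply/imsetP; exists (r (a * e)%N, r (b * e)%N).
  by rewrite inE /= coprime_gcdn_mod -muln_gcdl coprimeMl co_ab.
by rewrite /f pE /= !expc_mod !(expgM c).
Qed.

(** Classes correspond to unit orbits, all of size [totient k], on a set of [totient k] times psi(k)
    pairs; the factor [totient k] cancels. *)
Lemma nb_regular_dessins_psi : ((nb_regular_dessins G)%:R = dedekind_psi k)%R.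
Proof.
have [eqU] := equivalence_partition_imset (@dessin_iso_equiv _ G)
  dessin_iso_unit_multiple.
rewrite /nb_regular_dessins /iso_classes => ->;
  rewrite imset_power_pair in eqU *.
have t_neq0 : ((totient k)%:R != 0 :> rat)%R by rewrite pnatr_eq0 -lt0n
  totient_gt0.
apply: (mulfI t_neq0); rewrite -card_primitive_pairs // mulrC -natrM;
  congr (_%:R)%R.
rewrite -(card_uniform_partition _ (equivalence_partitionP eqU)).
  rewrite card_in_imset // => -[a b] [a' b'] _ _ [] /eqP + /eqP.
  rewrite !eq_expg_mod_order order_c !modn_small // => /eqP ea /eqP eb.
  by congr pair; apply: val_inj.
by move=> _ /imsetP[p Sp ->]; apply: card_unit_multiple.
Qed.

(** * Symmetric dessins and square roots of 1 modulo k *)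

Let sym_dessins := [set d in dessins G | symmetric_dessin G d].

(** Swapping gives y^n = (x^n)^e and x^n = (y^n)^e for one unit [e]. Hence x^n alone generates
    [<[c]>], has order [k], and equals its own power with exponent [e ^ 2]. *)
Let symmetric_ratio d : d \in sym_dessins ->
  exists e : 'I_k,
    [/\ e ^ 2 == 1 %[mod k], #[d.1 ^+ n] = k & d.2 ^+ n = d.1 ^+ n ^+ e].
Proof.
rewrite inE => /andP[Dd]; have [Gx Gy] := dessin_memG Dd.
rewrite /symmetric_dessin -/(dessin_iso G d _) dessin_iso_unit_multiple
  ?dessin_swap //.
case/existsP=> e /andP[co_e /eqP[/= yE xE]].
have o_x : #[d.1 ^+ n] = k.
  have : c \in <[d.1 ^+ n]>.
    have [i [j uE]] := dessin_expE abG Dd Gu.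
    rewrite /c uE (expgM_abelian abG) ?groupX // -!expgM ![(_ * n)%N]mulnC
      !expgM yE.
    by rewrite -[_ ^+ e ^+ j]expgM groupM ?mem_cycle.
  have [i ->] := expn_cycle Gx => /cycleP[j cE].
  apply/eqP; rewrite eqn_dvd -{3}order_c {2}cE; apply/andP; split;
    last exact: orderXdvd.
  by rewrite -[X in _ %| X]order_c; apply: orderXdvd.
exists e; split=> //.
have : d.1 ^+ n ^+ (e ^ 2) == d.1 ^+ n ^+ 1 by rewrite expg1 expgM -yE -xE.
by rewrite eq_expg_mod_order o_x.
Qed.

Lemma nb_symmetric_dessins_sqrt1 :
  nb_symmetric_dessins G = #|[set e : 'I_k | e ^ 2 == 1 %[mod k]]|.
Proof.
(* The default value is never reached on symmetric dessins, where the exponent exists and is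
   unique. *)
pose f (d : gT * gT) :=
  odflt (Ordinal k_gt0) [pick e : 'I_k | d.2 ^+ n == d.1 ^+ n ^+ e].
have fE d : d \in sym_dessins ->
    [/\ f d ^ 2 == 1 %[mod k], #[d.1 ^+ n] = k & d.2 ^+ n = d.1 ^+ n ^+ f d].
  move=> /symmetric_ratio[e [e2 o_x yE]]; rewrite /f;
    case: pickP => [e' /eqP yE'|/(_ e)]; last first.
    by rewrite yE eqxx.
  suff -> : e' = e by [].
  by apply: (expg_ord_inj o_x); rewrite -yE -yE'.
have symD d : d \in sym_dessins -> d \in dessins G by rewrite inE => /andP[].
have fR : {in sym_dessins &, forall d d', dessin_iso G d d' = (f d == f d')}.
  move=> d d' Sd Sd'; rewrite dessin_iso_unit_multiple ?symD //.
  have [e2 o_x yE] := fE d Sd; have [e2' o_x' yE'] := fE d' Sd'.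
  (* A common exponent [t] preserves the ratio of the two n-th powers. Conversely, both first
     entries generate [<[c]>], so they differ by a unit exponent, and equal ratios carry it to the
     second entries. *)
  apply/existsP/eqP => [[t /andP[_ /eqP[/= xt yt]]]|ff'].
    apply: (expg_ord_inj o_x'); rewrite -yE' yt yE xt.
    by rewrite -[LHS]expgM -[RHS]expgM mulnC.
  have [Gx Gy] := dessin_memG (symD _ Sd);
    have [Gx' Gy'] := dessin_memG (symD _ Sd').
  have : d'.1 ^+ n \in <[d.1 ^+ n]>.
    have -> : <[d.1 ^+ n]> = <[c]>.
      apply/eqP; rewrite eqEcard -!orderE o_x order_c leqnn andbT cycle_subG.
      by have [i ->] := expn_cycle Gx; rewrite mem_cycle.
    by have [i ->] := expn_cycle Gx'; rewrite mem_cycle.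
  case/cyclePmin=> t; rewrite o_x => lt_t xt; exists (Ordinal lt_t) => /=.
  apply/andP; split.
    by rewrite -o_x; apply: coprime_order_expg; rewrite -xt o_x o_x'.
  rewrite /power_pair yE' yE -ff' xt; apply/eqP; congr pair.
  by rewrite -[LHS]expgM -[RHS]expgM mulnC.
have eqS : {in sym_dessins & &, equivalence_rel (dessin_iso G)}.
  by move=> x y z /symD Dx /symD Dy /symD Dz; apply: dessin_iso_equiv Dx Dy Dz.
have [_ ] := equivalence_partition_imset eqS fR.
rewrite /nb_symmetric_dessins /iso_classes => ->.
have -> : f @: sym_dessins = [set e : 'I_k | e ^ 2 == 1 %[mod k]].
  apply/setP=> e; rewrite inE; apply/imsetP/idP => [[d /fE[e2 _ _] ->] //|e2].
  have co_e := coprime_of_expn2_mod e2.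
  (* A root [e] is realized by a dessin with pair of n-th powers (c, c^e). *)
  have /imsetP[d Dd dE] : (c, c ^+ e) \in power_pair @: dessins G.
    rewrite imset_power_pair; apply/imsetP;
      exists (Ordinal (ltn_pmod 1 k_gt0), e).
      by rewrite inE /= -(modn_small (ltn_ord e)) coprime_gcdn_mod gcd1n
        coprime1n.
    by rewrite /= expc_mod expg1.
  have Sd : d \in sym_dessins.
    rewrite inE Dd /symmetric_dessin -/(dessin_iso G d _).
    rewrite dessin_iso_unit_multiple ?dessin_swap //; apply/existsP; exists e.
    rewrite co_e -dE /=; case: dE => xE yE; rewrite /power_pair /= -xE -yE.
    apply/eqP; congr pair; apply/eqP; rewrite -[X in _ == X]expgM -{1}[c]expg1.
    by rewrite eq_expg_mod_order order_c eq_sym.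
  exists d => //; have [_ o_x yE] := fE d Sd; case: dE => xE' yE'.
  by apply: (expg_ord_inj order_c);
    rewrite [RHS](congr1 (fun z => z ^+ _) xE') -yE -yE'.
(* The target relation is equality, whose classes are singletons. *)
rewrite /equivalence_partition card_in_imset // => e1 e2; rewrite inE => E1 _.
by move=> /setP/(_ e1); rewrite !inE E1 eqxx => /esym/eqP.
Qed.

End DessinClasses.

(** * Uniqueness and total symmetry *)

(** Every factor 1 + 1/q is at least 1, so psi(k) is at least [k]. *)
Lemma dedekind_psi_eq1 k : 0 < k -> (dedekind_psi k = 1)%R <-> k = 1%N.
Proof.
move=> k_gt0; split=> [psi1|->]; last by rewrite /dedekind_psi big_nil mulr1.
have : (k%:R <= dedekind_psi k)%R.
  rewrite ler_peMr ?ler0n //; elim/big_ind: _ => // [x y|q _];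
    first exact: mulr_ege1.
  by rewrite lerDl invr_ge0 ler0n.
by rewrite psi1 (ler_nat _ k 1) => k_le1; apply/eqP; rewrite eqn_leq k_le1.
Qed.

Section Uniqueness.

Variables (gT : finGroupType) (G : {group gT}).

Lemma underlies_uniqueE :
  underlies_unique_dessin G <-> nb_regular_dessins G = 1%N.
Proof.
have eqR := @dessin_iso_equiv _ G; split=> [[d Dd iso_d]|/eqP/cards1P[A defA]].
  apply/eqP/cards1P; exists (dessins G); apply/setP=> A; rewrite inE.
  apply/imsetP/eqP => [[d' Dd' ->]|->]; last first.
    by exists d => //; apply/setP=> z; rewrite [RHS]inE;
      case Dz: (z \in _) => //=; rewrite iso_d.
  apply/setP=> z; rewrite [LHS]inE; case: (boolP (z \in _)) => //= Dz.
  by rewrite -(eqR d d' z Dd Dd' Dz).2 ?iso_d.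
have cl_d d : d \in dessins G -> [set z in dessins G | dessin_iso G d z] = A.
  by move=> Dd; apply/set1P; rewrite -defA; apply: imset_f.
have /imsetP[d Dd AE] : A \in iso_classes G (dessins G) by rewrite defA set11.
exists d => // d' Dd';
  have : d' \in A by rewrite -(cl_d d') // inE Dd' (eqR d' d' d' Dd' Dd' Dd').1.
by rewrite AE inE => /andP[].
Qed.

(* Defs.F2 is qualified because all_solvable exports another F2. *)
Lemma F2eval_dessin (s : {multiplicative Defs.F2 -> Defs.F2}) d : bijective s ->
  d \in dessins G ->
  (F2eval d.1 d.2 (s F2X), F2eval d.1 d.2 (s F2Y)) \in dessins G.
Proof.
case=> t sK tK; rewrite !inE /=; set x' := F2eval _ _ _; set y' := F2eval _ _ _.
move=> /eqP defG.
have ev_mem (H : {group gT}) a b w : a \in H -> b \in H -> F2eval a b w \in H.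
  move=> Ha Hb; apply: group_prod => -[g e] _; rewrite /leval /=.
  by case: g; case: e; rewrite ?groupV.
(* Both sides are homomorphisms on the free group with the same values on the generators. *)
have evE w : F2eval d.1 d.2 (s w) = F2eval x' y' w.
  apply: (@F2eval_unique gT (F2eval d.1 d.2 \o s)) => a b /=.
  by rewrite gmulfM F2evalM.
have [Gx Gy] : d.1 \in G /\ d.2 \in G by rewrite -defG !mem_gen ?inE ?eqxx
  ?orbT.
rewrite eqEsubset gen_subG; apply/andP; split.
  by apply/subsetP=> z /set2P[] ->; apply: ev_mem.
(* As [s] is onto, each free generator is [s] of some word, so each entry of [d] is that word
   evaluated at x', y'. *)
rewrite -{1}defG gen_subG; apply/subsetP=> z /set2P[] ->.
  rewrite -(F2evalX d.1 d.2) -(tK F2X) evE.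
  by apply: (ev_mem <<_>>%G); rewrite mem_gen ?set21 ?set22.
rewrite -[X in X \in _](F2evalY d.1 d.2) -(tK F2Y) evE.
by apply: (ev_mem <<_>>%G); rewrite mem_gen ?set21 ?set22.
Qed.

Lemma unique_totally_symmetric : underlies_unique_dessin G ->
  {in dessins G, forall d, totally_symmetric_dessin G d}.
Proof.
case=> d0 D0 iso0 d Dd s s_bij.
have Ds := F2eval_dessin s_bij Dd.
by rewrite -/(dessin_iso G d _) -(dessin_iso_equiv D0 Dd Ds).2 ?iso0.
Qed.

End Uniqueness.

Local Close Scope group_scope.

Theorem theorem4p11 (n m : nat) (gT : finGroupType) (G : {group gT})
    (n_gt0 : 1 <= n) (le_nm : n <= m) (dvd_nm : n %| m)
    (isoG : G \isog setX (Zp n) (Zp m)) :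
  [/\ ((nb_regular_dessins G)%:R = dedekind_psi (m %/ n))%R,
      nb_symmetric_dessins G
        = #|[set e : 'I_(m %/ n) | e ^ 2 == 1 %[mod m %/ n]]|
    & (underlies_unique_dessin G <-> m = n) /\
      (m = n -> {in dessins G, forall d, totally_symmetric_dessin G d})].
Proof.
have m_gt0 := leq_trans n_gt0 le_nm.
have [abG cardG [u [v [Gu Gv o_u v_n genG]]]] := isog_Zp_product n_gt0 m_gt0
  isoG.
have mE : m = (n * (m %/ n))%N by rewrite mulnC divnK.
have k_gt0 : 0 < m %/ n by rewrite divn_gt0.
have k_eq1 : m %/ n = 1%N <-> m = n.
  by split=> [k1|->]; [rewrite mE k1 muln1 | rewrite divnn n_gt0].
rewrite [X in (_ * X)%N]mE in cardG; rewrite [RHS]mE in o_u.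
have nb_reg := nb_regular_dessins_psi n_gt0 k_gt0 abG cardG Gu Gv o_u v_n genG.
have unique_iff : underlies_unique_dessin G <-> m = n.
  rewrite underlies_uniqueE -k_eq1 -(dedekind_psi_eq1 k_gt0) -nb_reg.
  by split=> [->|/eqP]; rewrite ?pnatr_eq1 // => /eqP.
split=> //; last by split=> // /unique_iff; apply: unique_totally_symmetric.
exact: nb_symmetric_dessins_sqrt1 n_gt0 k_gt0 abG cardG Gu Gv o_u v_n genG.
Qed.
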